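(* For all integers $m,p\geq 1$ and $q\geq 2$, the number $$(-1)^{m-1}\sum_{\substack{i+j=p-1\\ i,j\geq 0}}\binom{m+i-1}{i}\binom{q+j-1}{j}R_{m+i,q+j}+(-1)^{p-1}\sum_{\substack{i+j=m-1\\ i,j\geq 0}}\binom{p+i-1}{i}\binom{q+j-1}{j}R_{p+i,q+j}$$ lies in $\mathbb{Q}[\ln(2),\text{zeta values}]$. In particular, it is equal to $$\begin{aligned}&\binom{m+p+q-2}{q-1}\tilde t(m+p+q-1)\\&+(-1)^m\sum_{\substack{i+j=p-1\\ i,j\geq 0}}\binom{m+i-1}{i}\binom{q+j-1}{j}(-1)^{m+i}\zeta(m+i)\,\tilde t(q+j)\\&+(-1)^p\sum_{\substack{i+j=m-1\\ i,j\geq 0}}\binom{p+i-1}{i}\binom{q+j-1}{j}(-1)^{p+i}\zeta(p+i)\,\tilde t(q+j)\\&-\sum_{\substack{i+j=q-1\\ i,j\geq 0}}\binom{m+i-1}{i}\binom{p+j-1}{j}\tilde t(m+i)\,\tilde t(p+j),\end{aligned}$$ where, by convention, $\zeta(1):=-2\ln(2)$ and $\tilde t(1):=0$ wherever they occur.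
   Context: For integers $n\ge 0$, $r\geq 1$: $H_0^{(r)}=0$ and $H_n^{(r)}=\sum_{k=1}^n\frac{1}{k^r}$. For integers $p\geq 1$, $q\geq 2$: $R_{p,q}=\sum_{n=1}^\infty\frac{H_{n-1}^{(p)}}{(n-1/2)^q}$. For integers $s\geq 2$: $\zeta(s)=\sum_{n\geq1}n^{-s}$ is the Riemann zeta value and $\tilde t(s)=\sum_{n=1}^\infty\frac{1}{(n-1/2)^s}=(2^s-1)\zeta(s)$. $\mathbb{Q}[\ln(2),\text{zeta values}]$ denotes the $\mathbb{Q}$-subalgebra of $\mathbb{R}$ generated by $\ln 2$ and the numbers $\zeta(k)$, $k\geq 2$ an integer. *)

(* Defs.v *)
From HB Require Import structures.
From mathcomp Require Import all_boot all_order all_algebra.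
From mathcomp Require Import all_classical all_reals all_analysis.

Set Implicit Arguments.
Unset Strict Implicit.
Unset Printing Implicit Defensive.

Import Order.TTheory GRing.Theory Num.Theory.
Import numFieldNormedType.Exports.

Local Open Scope classical_set_scope.
Local Open Scope ring_scope.

Section Definitions.
Variable R : realType.
Implicit Types (n p q r s N : nat).

Definition harmonic_number n r : R := \sum_(1 <= k < n.+1) (k%:R ^+ r)^-1.

(* The infinite sums below are limits of partial sums; they converge in the
   ranges p >= 1, q >= 2 and s >= 2 in which they are used. *)
Definition Rsum p q : R :=
  \big[+%R/0]_(1 <= n <oo) (harmonic_number n.-1 p / (n%:R - 2^-1) ^+ q).

Definition zeta s : R := \big[+%R/0]_(1 <= n <oo) (n%:R ^+ s : R)^-1.

Definition ttilde s : R := \big[+%R/0]_(1 <= n <oo) ((n%:R - 2^-1) ^+ s : R)^-1.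

(* The divergent values at s = 1 are replaced by conventional ones. *)
Definition zeta_conv s : R := if s == 1%N then - 2 * ln 2 else zeta s.

Definition ttilde_conv s : R := if s == 1%N then 0 else ttilde s.

(* Sum of F i j over all pairs of natural numbers i, j with i + j = N. *)
Definition sum_antidiag N (F : nat -> nat -> R) : R :=
  \sum_(i < N.+1) F i (N - i)%N.

Definition is_Qsubalgebra (A : set R) : Prop :=
  [/\ A 1,
      forall x y, A x -> A y -> A (x + y),
      forall x y, A x -> A y -> A (x * y) &
      forall (a : rat) x, A x -> A (ratr a * x)].

Definition Q_ln2_zeta : set R :=
  smallest is_Qsubalgebra
    [set x | x = ln 2 \/ exists k : nat, (2 <= k)%N /\ x = zeta k].

End Definitions.

(* Main.v *)
Require Import Defs.
From HB Require Import structures.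
From mathcomp Require Import all_boot all_order all_algebra.
From mathcomp Require Import all_classical all_reals all_analysis.
From mathcomp Require Import ring lra zify.

Import Order.TTheory GRing.Theory Num.Theory.
Import numFieldNormedType.Exports.

Local Open Scope ring_scope.

(**
   Write a_k = k + 1/2 for k >= 0, and F_m(u) for the sum over k of (a_k - u)^-m.
   The identity says that the residues of F_m(u) F_p(u) / u^q add up to 0.  The
   residue at u = 0 collects the products ttilde (m + i) * ttilde (p + j).  At
   u = a_k the product of the two principal parts contributes to the single
   value ttilde (m + p + q - 1), and the principal part of one factor, multiplied
   by the Taylor expansion of the other, contributes sums over l <> k of
   (l - k)^-r, that is zeta r + (-1)^r * H_k^(r), with weight a_k^-s.  Summed
   over k these give zeta r * ttilde s and Rsum r s.

   For the truncations k < N everything is a finite sum of partial fraction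
   identities, one for each pair of poles a_k, a_l ([partial_fractions] when
   k <> l, [local_part_diag] when k = l); this gives [finite_identity].

   If m or p is 1 the sums F_1 diverge as N grows, and both sides contain terms
   of size log N.  Replacing F_1(u) by F_1(u) - F_1(0) at each N keeps an exact
   identity ([finite_identity_regularized]): the residues of (a_k - u)^-p u^-q
   at its two poles are opposite, and u^-q has residue 0 because q >= 2.  After
   this change every term converges.  The constant term at u = 0 becomes 0, and
   H_N minus the sum of the 1 / a_k, k < N, equals 2 H_N - 2 H_2N and tends to
   - 2 ln 2.  These are the conventional values of ttilde and zeta at 1.

   The passage to the limit ([limit_identity]) is a dominated convergence
   argument ([tannery0]): the error H_N^(r) - H_(N-1-k)^(r) made at the k-th
   pole by truncating tends to 0 for each k and never exceeds H_(k+1), while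
   the series of (H_(k+1) + 1) / ((k + 1) (k + 2)) converges.

   Membership in the algebra generated by ln 2 and the zeta values follows from
   the closed formula, because ttilde s = (2^s - 1) zeta s ([ttildeE]).
*)

(** * Partial fractions with three poles *)

Section Algebra.
Context {F : fieldType}.
Implicit Types (x y z a b : F) (e f g i m p q : nat).

(** The coefficient of u^i in (x - u)^-f.  Truncated subtraction makes it right for
    f = 0 too: it is 1 for i = 0 and 0 for i > 0. *)
Definition pole_coef x f i : F := 'C(f + i - 1, i)%:R * x ^- (f + i).

(** The coefficient of u^(e-1) in (y - u)^-f (z - u)^-g, that is the residue at
    u = 0 of this function divided by u^e; it is 0 for e = 0. *)
Definition local_part y z f g e : F :=
  \sum_(i < e) pole_coef y f i * pole_coef z g (e.-1 - i).

Lemma pole_coef00 x : pole_coef x 0 0 = 1.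
Proof. by rewrite /pole_coef bin0 expr0 invr1 mulr1. Qed.

Lemma pole_coef0S x i : pole_coef x 0 i.+1 = 0.
Proof. by rewrite /pole_coef add0n subn1 bin_small ?mul0r. Qed.

Lemma pole_coefS0 x f : x != 0 -> x * pole_coef x f.+1 0 = pole_coef x f 0.
Proof.
by move=> x0; rewrite /pole_coef !bin0 !mul1r !addn0 exprS invfM mulVKf.
Qed.

Lemma pole_coefSS x f i : x != 0 ->
  x * pole_coef x f.+1 i.+1 = pole_coef x f i.+1 + pole_coef x f.+1 i.
Proof.
move=> x0; rewrite /pole_coef !addSn !addnS !subSS !subn0 binS natrD.
by rewrite exprS invfM mulrCA mulVKf // mulrDl.
Qed.

Lemma local_part0 y z f g : local_part y z f g 0 = 0.
Proof. by rewrite /local_part big_ord0. Qed.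

Lemma local_partC y z f g e : local_part y z f g e = local_part z y g f e.
Proof.
case: e => [|e]; rewrite /local_part ?big_ord0 // (reindex_inj rev_ord_inj) /=.
apply: eq_bigr => i _; rewrite subSS mulrC; congr (_ * pole_coef _ _ _).
by rewrite subKn // -ltnS.
Qed.

(** Multiplication of (y - u)^-(f+1) by y = (y - u) + u. *)
Lemma local_partS y z f g e : y != 0 ->
  y * local_part y z f.+1 g e.+1
  = local_part y z f g e.+1 + local_part y z f.+1 g e.
Proof.
move=> y0; rewrite /local_part 2!big_ord_recl /= mulrDr mulrA pole_coefS0 //.
rewrite -addrA; congr (_ + _); rewrite mulr_sumr -big_split /=.
apply: eq_bigr => i _; rewrite mulrA /bump /= add1n pole_coefSS // mulrDl.
by rewrite -subn1 -subnDA.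
Qed.

(** Multiplication of (y - u)^-(f+1) (z - u)^-(g+1) by (z - u) - (y - u). *)
Lemma local_part_sub y z f g e : y != 0 -> z != 0 ->
  (z - y) * local_part y z f.+1 g.+1 e
  = local_part y z f.+1 g e - local_part y z f g.+1 e.
Proof.
move=> y0 z0.
have hy := local_partS y z f g.+1 e y0.
have hz := local_partS z y g f.+1 e z0.
case: e hy hz => [|e] _ _; first by rewrite !local_part0 subr0 mulr0.
have hy := local_partS y z f g.+1 e y0.
have := local_partS z y g f.+1 e z0.
rewrite ![local_part z y _ _ _]local_partC => hz.
by rewrite mulrBl hy hz; ring.
Qed.

Lemma local_part0l y z p q :
  local_part y z 0 p q.+1 = pole_coef z p q.
Proof.
rewrite /local_part big_ord_recl /= pole_coef00 mul1r subn0 big1 ?addr0 //.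
by move=> i _; rewrite pole_coef0S mul0r.
Qed.

(** The residue theorem for (0 - u)^-(q+1) (x - u)^-(p+1), which has only two poles:
    both residues are, up to sign, the same binomial coefficient times
    x^-(p+q+1). *)
Lemma pole_coef_swap x p q : x != 0 ->
  (-1) ^+ q.+1 * pole_coef x p.+1 q
  + (-1) ^+ p.+1 * pole_coef (- x) q.+1 p = 0.
Proof.
move=> x0; rewrite /pole_coef !addSn !subSS !subn0.
rewrite -(bin_sub (leq_addl p q)) addnK (addnC q p).
rewrite [(- x) ^+ _]exprNn invfM invr_sign.
have -> : (-1 : F) ^+ (p + q).+1 = - ((-1) ^+ p * (-1) ^+ q).
  by rewrite exprS exprD; ring.
rewrite exprS [(-1) ^+ p.+1]exprS.
have hs := sqrr_sign F p.
move: ((-1) ^+ p) ((-1) ^+ q) hs (x ^- _) ('C(_, _)%:R) => s t hs y c.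
have -> : -1 * t * (c * y) + -1 * s * (c * (- (s * t) * y))
  = (s ^+ 2 - 1) * (t * c * y) by ring.
by rewrite hs subrr mul0r.
Qed.

(** The residue theorem for (0 - u)^-(q+1) (a - u)^-m (b - u)^-p, whose poles are
    0, a and b.  Multiplying by b - a = (b - u) - (a - u) lowers the order of one of
    the last two poles, and this relation holds for each residue separately; so
    an induction reduces to the case where one of these poles is absent. *)
Lemma residue_sum0 a b m p q : a != 0 -> b != 0 -> a != b -> (0 < m + p)%N ->
  (-1) ^+ q.+1 * local_part a b m p q.+1
  + (-1) ^+ m * local_part (b - a) (- a) p q.+1 m
  + (-1) ^+ p * local_part (a - b) (- b) m q.+1 p = 0.
Proof.
move=> a0 b0 ab.
have ba0 : b - a != 0 by rewrite subr_eq0 eq_sym.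
have ab0 : a - b != 0 by rewrite subr_eq0.
(* q.+1 > 0, so the pole at 0 is always present in the base cases. *)
move mp: (m + p)%N => n; elim: n m p mp => // n IHn [|m] [|p] // hmp _.
- by rewrite !local_part0 !local_part0l mulr0 addr0 pole_coef_swap.
- by rewrite local_partC !local_part0 !local_part0l mulr0 addr0 pole_coef_swap.
move: hmp; rewrite addSn => -[hmp].
have h1 := local_part_sub a b m p q.+1 a0 b0.
have h2 := local_partS (b - a) (- a) p q.+1 m ba0.
have h3 := local_partS (a - b) (- b) m q.+1 p ab0.
have n0 : (0 < n)%N by rewrite -hmp addnS.
have i1 := IHn m p.+1 hmp n0.
have i2 : _ := IHn m.+1 p _ n0; rewrite addSn -addnS in i2; have {}i2 := i2 hmp.
apply: (mulfI ba0); rewrite mulr0 -[RHS](subrr 0) -{1}i2 -i1.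
move: h1 h2 h3; rewrite -(opprB b a) mulNr !exprS.
move: (local_part _ _ _ _ _) (local_part _ _ _ _ _) (local_part _ _ _ _ _) => A2 A1 X.
move: (local_part _ _ _ _ _) (local_part _ _ _ _ _) (local_part _ _ _ _ _) => Y2 Y1 Y.
move: (local_part _ _ _ _ _) (local_part _ _ _ _ _) (local_part _ _ _ _ _) => Z2 Z1 Z.
move: ((-1) ^+ q) ((-1) ^+ m) ((-1) ^+ p) (b - a) => s u v c h1 h2 h3.
have -> : c * (-1 * s * X + -1 * u * Y + -1 * v * Z)
  = - s * (c * X) - u * (c * Y) + v * (- (c * Z)) by ring.
by rewrite h1 h2 h3; ring.
Qed.

(** Minus the residue at u = a of u^-q (a - u)^-m (b - u)^-p. *)
Definition pfrac m p q a b : F :=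
  \sum_(i < m) (-1) ^+ i * 'C(p + i - 1, i)%:R
     * 'C(q + (m.-1 - i) - 1, m.-1 - i)%:R
     * ((b - a) ^- (p + i) * a ^- (q + (m.-1 - i))).

Lemma pfracE a b m p q :
  pfrac m p q a b = (-1) ^+ (q + m).+1 * local_part (b - a) (- a) p q m.
Proof.
rewrite /pfrac /local_part mulr_sumr; apply: eq_bigr => i _.
rewrite /pole_coef [(- a) ^+ _]exprNn invfM invr_sign.
move: (nat_of_ord i) (ltn_ord i) => {}i im.
have -> : (-1 : F) ^+ i = (-1) ^+ (q + m).+1 * (-1) ^+ (q + (m.-1 - i)).
  rewrite -exprD.
  have -> : ((q + m).+1 + (q + (m.-1 - i)) = i + (q + m - i) * 2)%N by lia.
  by rewrite exprD exprM sqrr_sign mulr1.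
by rewrite !mulrA; ring.
Qed.

(** [residue_sum0] solved for the residue at 0. *)
Lemma partial_fractions a b m p q :
  a != 0 -> b != 0 -> a != b -> (0 < m + p)%N ->
  local_part a b m p q.+1 = pfrac m p q.+1 a b + pfrac p m q.+1 b a.
Proof.
move=> a0 b0 ab mp; have := residue_sum0 a b m p q a0 b0 ab mp.
rewrite !pfracE; move: (local_part _ _ _ _ _) => X.
rewrite !addSn !exprS exprD exprD.
move: (local_part _ _ _ _ _) (local_part _ _ _ _ _) => Y Z h.
have /(congr1 (fun t => (-1) ^+ q * t)) := h; rewrite mulr0 => {}h.
have := signrMK (R := F) q X => hq.
apply/eqP; rewrite -subr_eq0 -[X]hq -oppr_eq0 -{}h; apply/eqP; ring.
Qed.

(** When the poles a and b collide, (a - u)^-m (a - u)^-p is (a - u)^-(m+p): this is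
    the Vandermonde convolution.  The induction moves one factor at a time, both
    distributions of it satisfying the recurrence [local_partS]. *)
Lemma local_part_diag a m p q : a != 0 ->
  local_part a a m p q.+1 = pole_coef a (m + p) q.
Proof.
move=> a0; rewrite -(local_part0l a a (m + p)).
elim: m p q.+1 => // m IHm p e; rewrite addSnnS -IHm.
elim: e => [|e IHe]; first by rewrite !local_part0.
apply: (mulfI a0).
rewrite local_partS // IHe [local_part a a m p.+1 e.+1]local_partC.
by rewrite local_partS // ![local_part a a _ m _]local_partC.
Qed.

End Algebra.

(** * The truncated identity *)

Section FiniteIdentity.
Context {R : realType}.
Implicit Types (N k l m p q s : nat).

Definition half_pt k : R := k%:R + 2^-1.

Definition ttilde_upto N s : R := \sum_(k < N) half_pt k ^- s.

(** The value at u = 0 of the truncated F_1, to be subtracted from all sums with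
    exponent 1 and from no other. *)
Definition counterterm N s : R := if s == 1%N then ttilde_upto N 1 else 0.

Definition shifted_harm N k s : R :=
  \sum_(l < N | l != k :> nat) (l%:R - k%:R) ^- s.

(** The correction c is 0 in the identity obtained directly from partial fractions
    and [counterterm N] in the one whose terms converge. *)
Definition weighted_harm (c : nat -> R) N r s : R :=
  \sum_(k < N) (shifted_harm N k r - c r) * half_pt k ^- s.

Lemma half_pt_gt0 k : 0 < half_pt k.
Proof. by rewrite ltr_wpDl ?ler0n ?invr_gt0 ?ltr0n. Qed.

Lemma half_pt_neq0 k : half_pt k != 0.
Proof. by rewrite gt_eqF ?half_pt_gt0. Qed.

Lemma half_ptB k l : half_pt l - half_pt k = l%:R - k%:R.
Proof. by rewrite /half_pt; ring. Qed.

Lemma sum_pfrac N m p q :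
  \sum_(k < N) \sum_(l < N | l != k) pfrac m.+1 p q (half_pt k) (half_pt l)
  = sum_antidiag m (fun i j => (-1) ^+ i * 'C(p + i - 1, i)%:R
      * 'C(q + j - 1, j)%:R * weighted_harm (fun=> 0) N (p + i) (q + j)).
Proof.
rewrite /pfrac /sum_antidiag /weighted_harm.
under [RHS]eq_bigr do rewrite mulr_sumr.
rewrite [RHS]exchange_big /=; apply: eq_bigr => k _.
rewrite exchange_big /=; apply: eq_bigr => i _.
rewrite /shifted_harm subr0 mulr_suml mulr_sumr.
by apply: eq_bigr => l _; rewrite half_ptB.
Qed.

Lemma sum_local_part N m p q :
  \sum_(k < N) \sum_(l < N) local_part (half_pt k) (half_pt l) m p q.+1
  = sum_antidiag q (fun i j => 'C(m + i - 1, i)%:R * 'C(p + j - 1, j)%:R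
      * (ttilde_upto N (m + i) * ttilde_upto N (p + j))).
Proof.
rewrite /local_part /sum_antidiag.
under [RHS]eq_bigr do rewrite /ttilde_upto mulr_suml mulr_sumr.
rewrite [RHS]exchange_big /=; apply: eq_bigr => k _.
rewrite exchange_big /=; apply: eq_bigr => i _.
rewrite !mulr_sumr; apply: eq_bigr => l _.
by rewrite /pole_coef mulrACA.
Qed.

(** Expand the products of truncated sums over pairs (k, l): the diagonal gives the
    single sum, and off the diagonal [partial_fractions] applies.  The two parts
    of the partial fraction differ by the exchange of k and l. *)
Lemma finite_identity N m p q :
  sum_antidiag q (fun i j => 'C(m.+1 + i - 1, i)%:R * 'C(p.+1 + j - 1, j)%:R
      * (ttilde_upto N (m.+1 + i) * ttilde_upto N (p.+1 + j)))
  = 'C(m.+1 + p.+1 + q - 1, q)%:R * ttilde_upto N (m.+1 + p.+1 + q)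
  + sum_antidiag m (fun i j => (-1) ^+ i * 'C(p.+1 + i - 1, i)%:R
      * 'C(q.+1 + j - 1, j)%:R * weighted_harm (fun=> 0) N (p.+1 + i) (q.+1 + j))
  + sum_antidiag p (fun i j => (-1) ^+ i * 'C(m.+1 + i - 1, i)%:R
      * 'C(q.+1 + j - 1, j)%:R * weighted_harm (fun=> 0) N (m.+1 + i) (q.+1 + j)).
Proof.
rewrite -sum_local_part -!sum_pfrac.
rewrite [X in _ = _ + X](exchange_big_dep xpredT) //=.
rewrite /ttilde_upto mulr_sumr -!big_split /=; apply: eq_bigr => k _.
rewrite (bigD1 k) //= local_part_diag ?half_pt_neq0 // -addrA; congr (_ + _).
under [X in _ = _ + X]eq_bigl do rewrite eq_sym.
rewrite -big_split /=; apply: eq_bigr => l lk.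
rewrite partial_fractions ?half_pt_neq0 //.
by rewrite -subr_eq0 half_ptB subr_eq0 eqr_nat eq_sym.
Qed.

Lemma counterterm_neq1 N s : s != 1%N -> counterterm N s = 0.
Proof. by rewrite /counterterm => /negPf ->. Qed.

Lemma antidiag_recl N (F : nat -> nat -> R) :
  (forall i, F i.+1 (N - i.+1)%N = 0) -> sum_antidiag N F = F 0%N N.
Proof.
move=> F0; rewrite /sum_antidiag big_ord_recl subn0 big1 ?addr0 // => i _.
exact: F0.
Qed.

Lemma sum_antidiagC N (F : nat -> nat -> R) :
  sum_antidiag N F = sum_antidiag N (fun i j => F j i).
Proof.
rewrite /sum_antidiag (reindex_inj rev_ord_inj) /=; apply: eq_bigr => i _.
by rewrite subSS subKn // -ltnS.
Qed.

Lemma eq_sum_antidiag N (F G : nat -> nat -> R) :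
  (forall i j, (i + j)%N = N -> F i j = G i j) ->
  sum_antidiag N F = sum_antidiag N G.
Proof.
by move=> FG; apply: eq_bigr => i _; rewrite FG // subnKC // -ltnS.
Qed.

Lemma sum_antidiagB N (F G : nat -> nat -> R) :
  sum_antidiag N (fun i j => F i j - G i j)
  = sum_antidiag N F - sum_antidiag N G.
Proof. by rewrite /sum_antidiag sumrB. Qed.

Lemma sum_antidiagD N (F G : nat -> nat -> R) :
  sum_antidiag N (fun i j => F i j + G i j)
  = sum_antidiag N F + sum_antidiag N G.
Proof. by rewrite /sum_antidiag big_split. Qed.

Lemma weighted_harm_regularized N r s :
  weighted_harm (counterterm N) N r s
  = weighted_harm (fun=> 0) N r s - counterterm N r * ttilde_upto N s.
Proof.
rewrite /weighted_harm mulr_sumr -sumrB; apply: eq_bigr => k _.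
by rewrite subr0 mulrBl.
Qed.

(** Only the index i = 0 can carry a counterterm, since the exponent p.+1 + i is 1
    only there. *)
Lemma sum_weighted_harm_regularized N m p q :
  sum_antidiag m (fun i j => (-1) ^+ i * 'C(p.+1 + i - 1, i)%:R
      * 'C(q.+1 + j - 1, j)%:R * weighted_harm (counterterm N) N (p.+1 + i) (q.+1 + j))
  = sum_antidiag m (fun i j => (-1) ^+ i * 'C(p.+1 + i - 1, i)%:R
      * 'C(q.+1 + j - 1, j)%:R * weighted_harm (fun=> 0) N (p.+1 + i) (q.+1 + j))
  - 'C(m + q, q)%:R * counterterm N p.+1 * ttilde_upto N (m.+1 + q).
Proof.
rewrite (eq_sum_antidiag _ _ (fun i j => (-1) ^+ i * 'C(p.+1 + i - 1, i)%:R
      * 'C(q.+1 + j - 1, j)%:R * weighted_harm (fun=> 0) N (p.+1 + i) (q.+1 + j)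
    - (-1) ^+ i * 'C(p.+1 + i - 1, i)%:R * 'C(q.+1 + j - 1, j)%:R
      * (counterterm N (p.+1 + i) * ttilde_upto N (q.+1 + j)))); last first.
  by move=> i j _; rewrite weighted_harm_regularized mulrBr.
rewrite sum_antidiagB; congr (_ - _); rewrite antidiag_recl => [|i]; last first.
  by rewrite counterterm_neq1 ?addnS // mul0r mulr0.
rewrite expr0 bin0 !mul1r addn0 !addSn subn1 /= [(q + m)%N]addnC.
by rewrite -(bin_sub (leq_addl m q)) addnK mulrA.
Qed.

Lemma sum_counterterm_ttilde N m p q :
  sum_antidiag q (fun i j => 'C(m.+1 + i - 1, i)%:R * 'C(p.+1 + j - 1, j)%:R
      * (counterterm N (m.+1 + i) * ttilde_upto N (p.+1 + j)))
  = 'C(p + q, q)%:R * counterterm N m.+1 * ttilde_upto N (p.+1 + q).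
Proof.
rewrite antidiag_recl => [|i]; last first.
  by rewrite counterterm_neq1 ?addnS // mul0r mulr0.
by rewrite bin0 !mul1r addn0 addSn subn1 mulrA.
Qed.

(** The corrections brought in by the counterterms are the same on both sides.  The
    product of two counterterms never occurs: the exponents m.+1 + i and p.+1 + j
    are not both 1 because i + j = q.+1 > 0. *)
Lemma finite_identity_regularized N m p q :
  sum_antidiag q.+1 (fun i j => 'C(m.+1 + i - 1, i)%:R * 'C(p.+1 + j - 1, j)%:R
      * ((ttilde_upto N (m.+1 + i) - counterterm N (m.+1 + i))
         * (ttilde_upto N (p.+1 + j) - counterterm N (p.+1 + j))))
  = 'C(m.+1 + p.+1 + q.+1 - 1, q.+1)%:R * ttilde_upto N (m.+1 + p.+1 + q.+1)
  + sum_antidiag m (fun i j => (-1) ^+ i * 'C(p.+1 + i - 1, i)%:R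
      * 'C(q.+2 + j - 1, j)%:R * weighted_harm (counterterm N) N (p.+1 + i) (q.+2 + j))
  + sum_antidiag p (fun i j => (-1) ^+ i * 'C(m.+1 + i - 1, i)%:R
      * 'C(q.+2 + j - 1, j)%:R * weighted_harm (counterterm N) N (m.+1 + i) (q.+2 + j)).
Proof.
rewrite !sum_weighted_harm_regularized -!sum_counterterm_ttilde.
rewrite [X in _ = _ + (_ - X) + _]sum_antidiagC.
have regroup (A D U E V : R) : A + (D - U) + (E - V) = A + D + E - (U + V) by ring.
rewrite regroup -finite_identity -sum_antidiagD -sum_antidiagB.
apply: eq_sum_antidiag => i j ij.
have -> : (ttilde_upto N (m.+1 + i) - counterterm N (m.+1 + i))
         * (ttilde_upto N (p.+1 + j) - counterterm N (p.+1 + j))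
  = ttilde_upto N (m.+1 + i) * ttilde_upto N (p.+1 + j)
  - counterterm N (p.+1 + j) * ttilde_upto N (m.+1 + i)
  - counterterm N (m.+1 + i) * ttilde_upto N (p.+1 + j)
  + counterterm N (m.+1 + i) * counterterm N (p.+1 + j) by ring.
have -> : counterterm N (m.+1 + i) * counterterm N (p.+1 + j) = 0.
  case: i ij => [|i] ij; last by rewrite counterterm_neq1 ?addnS // mul0r.
  by move: ij; rewrite add0n => ->; rewrite mulrC counterterm_neq1 ?mul0r // addnS.
by ring.
Qed.

End FiniteIdentity.

(** * Harmonic numbers and limits of the truncated sums *)

Section Limits.
Local Open Scope classical_set_scope.
Context {R : realType}.
Implicit Types (N k l m n p q r s : nat) (u v : nat -> R).
Local Notation H n r := (harmonic_number R n r).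

Lemma harmonic_numberE n r : H n r = \sum_(k < n) k.+1%:R ^- r.
Proof. by rewrite /harmonic_number big_add1 big_mkord. Qed.

Lemma harmonic_numberS n r : H n.+1 r = H n r + n.+1%:R ^- r.
Proof. by rewrite !harmonic_numberE big_ord_recr. Qed.

Lemma harmonic_number_ge0 n r : 0 <= H n r.
Proof.
by rewrite harmonic_numberE sumr_ge0 // => k _; rewrite invr_ge0 exprn_ge0.
Qed.

Lemma natVX_le_natV k r : (0 < r)%N -> (k.+1%:R : R) ^- r <= k.+1%:R^-1.
Proof.
case: r => // r _; rewrite exprS invfM ler_piMr ?invr_ge0 ?ler0n //.
by rewrite invf_le1 ?exprn_gt0 ?ltr0n // exprn_ege1 // ler1n.
Qed.

Lemma harmonic_number_le1 n r : (0 < r)%N -> H n r <= H n 1.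
Proof.
move=> r0; rewrite !harmonic_numberE ler_sum // => k _.
by rewrite expr1 natVX_le_natV.
Qed.

Lemma cvg_series_telescope u v :
  (forall n, 0 <= u n) -> (forall n, 0 <= v n) ->
  (forall n, u n <= v n - v n.+1) -> cvgn (series u).
Proof.
move=> u0 v0 uv; apply: nondecreasing_is_cvgn; first exact: nondecreasing_series.
exists (v 0%N) => _ [n _ <-]; apply: (@le_trans _ _ (v 0%N - v n)).
  rewrite -[leRHS]opprB -telescope_sumr // -sumrN.
  by apply: ler_sum => i _; rewrite opprB.
by rewrite lerBlDr lerDl.
Qed.

(** A summable sequence that dominates, up to a constant factor, every series below.
    It is a lower bound for the decrements of (H_(n+1) + 2) / (n + 1), which makes
    its convergence a telescoping argument. *)
Definition majorant n : R := (H n.+1 1 + 1) / (n.+1%:R * n.+2%:R).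

Lemma majorant_ge0 n : 0 <= majorant n.
Proof. by rewrite divr_ge0 ?mulr_ge0 ?ler0n // addr_ge0 ?harmonic_number_ge0. Qed.

Lemma cvg_series_majorant : cvgn (series majorant).
Proof.
apply: (@cvg_series_telescope _ (fun n => (H n.+1 1 + 2) / n.+1%:R)).
- exact: majorant_ge0.
- by move=> n; rewrite divr_ge0 ?ler0n // addr_ge0 ?harmonic_number_ge0.
move=> n; rewrite [H n.+2 1]harmonic_numberS expr1 /majorant.
move: (H n.+1 1) => h.
have n1 : (0 : R) < n.+1%:R by rewrite ltr0n.
have n2 : n.+2%:R = n.+1%:R + 1 :> R by rewrite -natr1.
rewrite n2; move: (n.+1%:R : R) n1 => x x0.
have x1 : 0 < x + 1 by lra.
rewrite -subr_ge0.
have -> : (h + 2) / x - (h + (x + 1)^-1 + 2) / (x + 1) - (h + 1) / (x * (x + 1))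
  = (x * (x + 1) ^+ 2)^-1 by field; rewrite !gt_eqF.
by rewrite invr_ge0 mulr_ge0 ?exprn_ge0 // ltW.
Qed.

Lemma cvg_series_dominated (c : R) u :
  (forall n, 0 <= u n <= c * majorant n) -> cvgn (series u).
Proof.
move=> ub; apply: (@series_le_cvg _ _ (c *: (majorant : R^o ^nat))) => [n|n|n|].
- by case/andP: (ub n).
- by case/andP: (ub n); apply: le_trans.
- by case/andP: (ub n).
exact: is_cvg_seriesZ cvg_series_majorant.
Qed.

(** The factor 2^s.+1 is forced by n = 0, where both sides are equal to 2^s. *)
Lemma inv_half_pt_le n s : (2 <= s)%N ->
  (half_pt n : R) ^- s <= 2 ^+ s.+1 / (n.+1%:R * n.+2%:R).
Proof.
case: s => // -[|s] // _.
have h0 := @half_pt_gt0 R n.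
have h2 : (half_pt n : R)^-1 <= 2.
  rewrite -[leRHS]invrK lef_pV2 ?posrE ?invr_gt0 ?ltr0n //.
  by rewrite lerDr.
have hs : (half_pt n : R) ^- s <= 2 ^+ s.
  by rewrite -exprVn lerXn2r // ?nnegrE ?invr_ge0 ?ltW.
have hh : (half_pt n : R) ^- 2 <= 8 / (n.+1%:R * n.+2%:R).
  rewrite ler_pdivlMr ?mulr_gt0 ?ltr0n // mulrC ler_pdivrMr ?exprn_gt0 //.
  have n0 : (0 : R) <= n%:R by rewrite ler0n.
  rewrite -[n.+2%:R]natr1 -[n.+1%:R]natr1 /half_pt.
  by nra.
rewrite -add2n exprD invfM; apply: (le_trans (ler_pM _ _ hh hs)).
- by rewrite invr_ge0 exprn_ge0 ?ltW.
- by rewrite invr_ge0 exprn_ge0 ?ltW.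
have -> : (2 : R) ^+ (2 + s).+1 = 8 * 2 ^+ s by rewrite !exprS; ring.
by rewrite mulrAC.
Qed.

Lemma inv_half_pt_weight_le (c : R) n s : (2 <= s)%N ->
  0 <= c <= H n.+1 1 + 1 ->
  0 <= c * half_pt n ^- s <= 2 ^+ s.+1 * majorant n.
Proof.
move=> s2 /andP[c0 cH].
have hp : 0 <= (half_pt n : R) ^- s by rewrite invr_ge0 exprn_ge0 // ltW ?half_pt_gt0.
rewrite mulr_ge0 //= /majorant mulrCA.
by apply: ler_pM => //; exact: inv_half_pt_le.
Qed.

(** Shifts the index: the series to be studied start at n = 1, the truncated sums at
    k = 0. *)
Lemma cvg_series_from1 (F G : nat -> R) : (forall k, G k.+1 = F k) ->
  cvgn (series F) -> \sum_(k < N) F k @[N --> \oo] --> \big[+%R/0]_(1 <= n <oo) G n.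
Proof.
move=> GF cF.
have sE : series F = (fun N => \sum_(k < N) F k).
  by apply/funext => N; rewrite /series /= big_mkord.
rewrite -sE; suff -> : \big[+%R/0]_(1 <= n <oo) G n = limn (series F) by [].
apply: cvg_lim => //; rewrite -cvg_shiftS /=.
rewrite [X in X @ _ --> _](_ : _ = series F) //; apply/funext => N.
by rewrite /series /= big_add1; apply: eq_bigr.
Qed.

Lemma cvg_zeta s : (2 <= s)%N -> H N s @[N --> \oo] --> zeta R s.
Proof.
move=> s2; under eq_fun do rewrite harmonic_numberE.
apply: (@cvg_series_from1 (fun k => k.+1%:R ^- s)) => //.
apply: (@cvg_series_dominated 2) => n; rewrite invr_ge0 exprn_ge0 //=.
have n1 : (1 : R) <= n.+1%:R by rewrite ler1n.
case: s s2 => // -[|s] // _.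
have n2 : (n.+1%:R : R) ^- s.+2 <= 2 / (n.+1%:R * n.+2%:R).
  rewrite !exprS mulrA invfM; apply: (@le_trans _ _ ((n.+1%:R * n.+1%:R)^-1)).
    rewrite ler_piMr ?invr_ge0 ?mulr_ge0 //.
    by rewrite invf_le1 ?exprn_gt0 ?ltr0n // exprn_ege1.
  rewrite ler_pdivlMr ?mulr_gt0 ?ltr0n // mulrC ler_pdivrMr ?mulr_gt0 ?ltr0n //.
  by rewrite -[n.+2%:R]natr1; nra.
apply: (le_trans n2); rewrite /majorant [leRHS]mulrA ler_pM2r.
  have := harmonic_number_ge0 n.+1 1; lra.
by rewrite invr_gt0 mulr_gt0 ?ltr0n.
Qed.

Lemma nat_half k : k.+1%:R - 2^-1 = half_pt k :> R.
Proof. by rewrite /half_pt -natr1; lra. Qed.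

Lemma cvg_ttilde s : (2 <= s)%N -> ttilde_upto N s @[N --> \oo] --> ttilde R s.
Proof.
move=> s2; apply: (@cvg_series_from1 (fun k => half_pt k ^- s)).
  by move=> k; rewrite nat_half.
apply: (@cvg_series_dominated (2 ^+ s.+1)) => n.
rewrite -[X in 0 <= X <= _]mul1r; apply: inv_half_pt_weight_le => //.
by rewrite ler01 lerDr harmonic_number_ge0.
Qed.

Lemma harmonic_weight_bound n r : (0 < r)%N -> 0 <= H n r <= H n.+1 1 + 1.
Proof.
move=> r0; rewrite harmonic_number_ge0 /=.
apply: (le_trans (harmonic_number_le1 n r r0)).
by rewrite harmonic_numberS -addrA lerDl addr_ge0.
Qed.

Lemma cvg_Rsum r s : (0 < r)%N -> (2 <= s)%N ->
  \sum_(k < N) H k r * half_pt k ^- s @[N --> \oo] --> Rsum R r s.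
Proof.
move=> r0 s2; apply: (@cvg_series_from1 (fun k => H k r * half_pt k ^- s)).
  by move=> k; rewrite nat_half.
apply: (@cvg_series_dominated (2 ^+ s.+1)) => n.
by apply: inv_half_pt_weight_le => //; exact: harmonic_weight_bound.
Qed.

Lemma cvg_bigsum (I : Type) (r : seq I) (u : I -> nat -> R) (l : I -> R) :
  (forall i, u i N @[N --> \oo] --> l i) ->
  \sum_(i <- r) u i N @[N --> \oo] --> \sum_(i <- r) l i.
Proof.
move=> ul; apply: (@cvg_big R I +%R 0 xpredT _ nat \oo r u l _ (fun i _ => ul i)).
exact: (@add_continuous R).
Qed.

(** Dominated convergence for sums whose length grows with the parameter: cut at a
    fixed K, beyond which the majorant leaves less than half of the tolerance; the
    first K terms tend to 0 one by one. *)
Lemma tannery0 (u : nat -> nat -> R) v :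
  (forall N n, (n < N)%N -> 0 <= u N n <= v n) -> cvgn (series v) ->
  (forall n, u N n @[N --> \oo] --> 0) ->
  \sum_(n < N) u N n @[N --> \oo] --> 0.
Proof.
move=> uv cv u0; apply/cvgr0Pnorm_le => e e0.
have e2 : 0 < e / 2 by rewrite divr_gt0.
have v0 n : 0 <= v n by have /andP[] := uv n.+1 n (ltnSn n); apply: le_trans.
have vnd : nondecreasing_seq (series v) by exact: nondecreasing_series.
have /cvgrPdist_le /(_ _ e2) [K _ tail] := cv.
have : \sum_(n < K) u N n @[N --> \oo] --> 0.
  rewrite [X in _ --> X](_ : _ = \sum_(n < K) (0 : R)); last by rewrite big1.
  by apply: cvg_bigsum => i; exact: u0.
move/cvgr0Pnorm_le => /(_ _ e2) head.
near=> N.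
have KN : (K <= N)%N by near: N; exact: nbhs_infty_ge.
rewrite ger0_norm; last first.
  by apply: sumr_ge0 => i _; have /andP[] := uv N i (ltn_ord i).
rewrite -(big_mkord xpredT (u N)) (@big_cat_nat _ _ _ K) //= big_mkord.
rewrite [leRHS](splitr e); apply: lerD.
  by apply: le_trans (ler_norm _) _; near: N.
apply: (@le_trans _ _ (\sum_(K <= i < N) v i)).
  by rewrite !big_nat; apply: ler_sum => i /andP[_ iN]; have /andP[] := uv N i iN.
have := sub_series v K N; rewrite KN => <-.
apply: le_trans (tail K (leqnn K)); apply: le_trans (ler_norm _).
by rewrite lerD2r nondecreasing_cvgn_le.
Unshelve. all: by end_near. Qed.

(** The points l > k contribute H_(N-1-k), and the points l < k contribute H_k with
    the sign of (-1)^r. *)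
Lemma shifted_harmE N k r : (0 < r)%N -> (k < N)%N ->
  shifted_harm N k r = H (N - k.+1) r + (-1) ^+ r * H k r.
Proof.
move=> r0 kN; rewrite /shifted_harm.
(* The term l = k may be included: it is the inverse of 0, which is 0. *)
have -> : \sum_(l < N | l != k :> nat) (l%:R - k%:R : R) ^- r
  = \sum_(l < N) (l%:R - k%:R) ^- r.
  rewrite [RHS](bigID (fun l : 'I_N => l != k :> nat)) /=.
  rewrite [X in _ = _ + X]big1 ?addr0 //.
  by move=> l; rewrite negbK => /eqP ->; rewrite subrr expr0n gtn_eqF // invr0.
rewrite -(big_mkord xpredT (fun l => (l%:R - k%:R : R) ^- r)).
rewrite (@big_cat_nat _ _ _ k) ?(ltnW kN) //= addrC; congr (_ + _).
  rewrite big_ltn // subrr expr0n gtn_eqF // invr0 add0r.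
  rewrite -[k.+1]add0n big_addn big_mkord harmonic_numberE add0n.
  by apply: eq_bigr => i _; rewrite addnS -addSn natrD addrK.
rewrite big_mkord (reindex_inj rev_ord_inj) /= harmonic_numberE mulr_sumr.
apply: eq_bigr => i _; rewrite natrB // addrAC subrr sub0r.
by rewrite [(- i.+1%:R) ^+ r]exprNn invfM invr_sign.
Qed.

(** Each 1 / (k + 1) lies between ln (k + 2) - ln (k + 1) and ln (k + 1) - ln k, and
    both bounds telescope. *)
Lemma cvg_ln2 : H N.*2 1 - H N 1 @[N --> \oo] --> (ln 2 : R).
Proof.
have lnS (x y : R) : 0 < x -> 0 < y -> ln x - ln y <= (x - y) / y.
  move=> x0 y0; rewrite -ln_div ?posrE //.
  have -> : x / y = 1 + (x - y) / y by field; rewrite gt_eqF.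
  apply: le_ln1Dx; rewrite ltr_pdivlMr // mulN1r ltrBrDl addrN //.
have HE N : H N.*2 1 - H N 1 = \sum_(N <= k < N.*2) k.+1%:R^-1.
  rewrite !harmonic_numberE -!(big_mkord xpredT (fun k => (k.+1%:R : R) ^- 1)).
  have N2 : (N <= N.*2)%N by rewrite -addnn leq_addr.
  by rewrite (big_cat_nat (leq0n N) N2) /= [LHS]addrC addKr.
apply: (@squeeze_cvgr _ _ _ _ (fun N => ln 2 - N.+1%:R^-1) (cst (ln 2))).
- near=> N; have N0 : (0 < N)%N by near: N; exact: nbhs_infty_gt.
  have N2 : (N <= N.*2)%N by rewrite -addnn leq_addr.
  have N0R : (0 : R) < N%:R by rewrite ltr0n.
  rewrite HE /=; apply/andP; split.
    apply: (@le_trans _ _ (ln N.*2.+1%:R - ln N.+1%:R)).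
      have -> : ln 2 = ln N.*2.+2%:R - ln N.+1%:R :> R.
        rewrite -ln_div ?posrE ?ltr0n //; congr ln.
        by rewrite -doubleS -muln2 natrM mulrAC mulfV ?mul1r ?pnatr_eq0.
      rewrite lerBlDr addrAC lerD2r -lerBlDl.
      apply: (le_trans (lnS _ _ _ _)); rewrite ?ltr0n //.
      rewrite -natr1 addrAC subrr add0r mul1r lef_pV2 ?posrE ?ltr0n //.
      by rewrite ler_nat ltnS.
    rewrite -(@telescope_sumr _ N N.*2 (fun k => ln k.+1%:R)) //.
    rewrite ler_sum // => k _; apply: (le_trans (lnS _ _ _ _)); rewrite ?ltr0n //.
    by rewrite -[k.+2%:R]natr1 addrAC subrr add0r mul1r.
  have -> : ln 2 = ln N.*2%:R - ln N%:R :> R.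
    rewrite -ln_div ?posrE ?ltr0n ?double_gt0 //; congr ln.
    by rewrite -muln2 natrM mulrAC mulfV ?mul1r // gt_eqF.
  rewrite -(@telescope_sumr _ N N.*2 (fun k => ln k%:R)) //.
  rewrite !big_nat ler_sum // => k /andP[Nk _].
  have k0 : (0 < k)%N by apply: leq_trans Nk.
  rewrite -lerN2 opprB; apply: (le_trans (lnS _ _ _ _)); rewrite ?ltr0n //.
  by rewrite -[k.+1%:R]natr1 opprD addrA subrr add0r mulN1r.
- rewrite -[X in _ --> X]subr0; apply: cvgB; first exact: cvg_cst.
  exact: cvg_harmonic.
- exact: cvg_cst.
Unshelve. all: by end_near. Qed.

(** The odd integers 2k + 1 up to 2N are the 2 * a_k, and the even ones are twice
    the integers up to N.  For r = 1 this turns H_N minus the counterterm into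
    2 H_N - 2 H_2N; for r > 1 its limit relates ttilde to zeta. *)
Lemma harmonic_number_double N r :
  H N.*2 r = 2 ^- r * (ttilde_upto N r + H N r).
Proof.
elim: N => [|N IHN].
  by rewrite double0 !harmonic_numberE /ttilde_upto !big_ord0 addr0 mulr0.
rewrite doubleS !harmonic_numberS IHN /ttilde_upto big_ord_recr /=.
rewrite addrACA [RHS]mulrDr -addrA; congr (_ + _).
rewrite mulrDr -!invfM -!exprMn; congr (_ ^- _ + _ ^- _).
  by rewrite /half_pt -natr1 -muln2 natrM; field.
by rewrite -doubleS -muln2 natrM mulrC.
Qed.

Lemma ttildeE s : (2 <= s)%N -> ttilde R s = (2 ^+ s - 1) * zeta R s.
Proof.
move=> s2.
have h1 : H N.*2 s @[N --> \oo] --> zeta R s.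
  apply: (@cvg_comp _ _ _ double (fun N => H N s) \oo \oo).
    move=> A [M _ AM]; exists M => // N /= MN; apply: AM => /=.
    by rewrite -addnn (leq_trans MN) // leq_addr.
  exact: cvg_zeta.
have h2 : H N.*2 s @[N --> \oo] --> 2 ^- s * (ttilde R s + zeta R s).
  under eq_fun do rewrite harmonic_number_double.
  by apply: cvgMl_tmp; apply: cvgD; [exact: cvg_ttilde | exact: cvg_zeta].
have zE : zeta R s = 2 ^- s * (ttilde R s + zeta R s).
  by apply: (cvg_unique _ h1 h2); exact: norm_hausdorff.
have : 2 ^+ s * zeta R s = ttilde R s + zeta R s.
  by rewrite {1}zE mulVKf // expf_neq0.
by rewrite mulrBl mul1r => ->; rewrite addrK.
Qed.

(** The conventional value - 2 ln 2 at s = 1 is the limit of the harmonic numbers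
    corrected by the counterterm. *)
Lemma cvg_zeta_conv s : (0 < s)%N ->
  H N s - counterterm N s @[N --> \oo] --> zeta_conv R s.
Proof.
rewrite /counterterm /zeta_conv; case: eqP => [-> _|/eqP s1 s0]; last first.
  by under eq_fun do rewrite subr0; apply: cvg_zeta; rewrite ltn_neqAle eq_sym s1.
have -> : (fun N => H N 1 - ttilde_upto N 1) = (fun N => - 2 * (H N.*2 1 - H N 1)).
  by apply/funext => N; rewrite harmonic_number_double; field.
by apply: cvgMl_tmp; exact: cvg_ln2.
Qed.

(** At s = 1 the counterterm cancels the whole sum, hence the conventional value 0. *)
Lemma cvg_ttilde_conv s : (0 < s)%N ->
  ttilde_upto N s - counterterm N s @[N --> \oo] --> ttilde_conv R s.
Proof.
rewrite /counterterm /ttilde_conv; case: eqP => [-> _|/eqP s1 s0]; last first.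
  by under eq_fun do rewrite subr0; apply: cvg_ttilde; rewrite ltn_neqAle eq_sym s1.
by under eq_fun do rewrite subrr; exact: cvg_cst.
Qed.

End Limits.

(** * The identity in the limit *)

Section LimitIdentity.
Local Open Scope classical_set_scope.
Context {R : realType}.
Implicit Types (N k l m n p q r s : nat) (u v : nat -> R).
Local Notation H n r := (harmonic_number R n r).

Lemma harmonic_numberB M j r :
  H (M + j) r - H M r = \sum_(i < j) (M + i).+1%:R ^- r.
Proof.
elim: j => [|j IHj]; first by rewrite addn0 subrr big_ord0.
by rewrite addnS harmonic_numberS big_ord_recr /= -IHj addrAC.
Qed.

(** The difference is the sum of the k + 1 terms i^-r with N - k <= i <= N, which are
    bounded term by term by 1, 1/2, ..., 1/(k + 1). *)
Lemma harmonic_tail_bound N k r : (0 < r)%N -> (k < N)%N ->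
  0 <= H N r - H (N - k.+1) r <= H k.+1 1.
Proof.
move=> r0 kN; rewrite -{1 3}(subnK kN) harmonic_numberB; apply/andP; split.
  by apply: sumr_ge0 => i _; rewrite invr_ge0 exprn_ge0.
rewrite harmonic_numberE ler_sum // => i _; apply: (le_trans (natVX_le_natV _ _ r0)).
by rewrite expr1 lef_pV2 ?posrE ?ltr0n // ler_nat ltnS leq_addl.
Qed.

Lemma cvg_harmonic_tail k r : (0 < r)%N ->
  H N r - H (N - k.+1) r @[N --> \oo] --> 0.
Proof.
move=> r0; rewrite -(cvg_shiftn k.+1) /=.
apply: (@squeeze_cvgr _ _ _ _ (cst 0) (fun M => k.+1%:R * M.+1%:R^-1)).
- near=> M => /=; rewrite addnK harmonic_numberB; apply/andP; split.
    by apply: sumr_ge0 => i _; rewrite invr_ge0 exprn_ge0.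
  rewrite mulr_natl -[X in _ *+ X]card_ord -sumr_const ler_sum // => i _.
  apply: (le_trans (natVX_le_natV _ _ r0)).
  by rewrite lef_pV2 ?posrE ?ltr0n // ler_nat ltnS leq_addr.
- exact: cvg_cst.
- rewrite [X in _ --> X](_ : _ = k.+1%:R * (0 : R)); last by rewrite mulr0.
  by apply: cvgMl_tmp; exact: cvg_harmonic.
Unshelve. all: by end_near. Qed.

Lemma cvg_harmonic_tail_sum r s : (0 < r)%N -> (2 <= s)%N ->
  \sum_(k < N) (H N r - H (N - k.+1) r) * half_pt k ^- s @[N --> \oo] --> 0.
Proof.
move=> r0 s2.
apply: (@tannery0 _ (fun N k => (H N r - H (N - k.+1) r) * half_pt k ^- s)
  (2 ^+ s.+1 *: (majorant : R^o ^nat))).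
- move=> N k kN; apply: inv_half_pt_weight_le => //.
  have /andP[-> h] := harmonic_tail_bound N k r r0 kN.
  by rewrite (le_trans h) // lerDl.
- exact: is_cvg_seriesZ cvg_series_majorant.
move=> k; rewrite [X in _ --> X](_ : _ = 0 * half_pt k ^- s); last by rewrite mul0r.
by apply: cvgMr_tmp; exact: cvg_harmonic_tail.
Qed.

(** Split off the full harmonic number: the sum around the pole k is
    (H_N - counterterm) - (H_N - H_(N-1-k)) + (-1)^r H_k.  The first part no longer
    depends on k, the second is a truncation error that disappears in the limit,
    and the third builds up [Rsum]. *)
Lemma cvg_weighted_harm r s : (0 < r)%N -> (2 <= s)%N ->
  weighted_harm (counterterm N) N r s @[N --> \oo]
    --> zeta_conv R r * ttilde R s + (-1) ^+ r * Rsum R r s.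
Proof.
move=> r0 s2.
have -> : (fun N => weighted_harm (counterterm N) N r s) = (fun N =>
    (H N r - counterterm N r) * ttilde_upto N s
    - \sum_(k < N) (H N r - H (N - k.+1) r) * half_pt k ^- s
    + (-1) ^+ r * \sum_(k < N) H k r * half_pt k ^- s).
  apply/funext => N; rewrite /weighted_harm /ttilde_upto.
  rewrite !mulr_sumr -sumrB -big_split /=.
  by apply: eq_bigr => k _; rewrite shifted_harmE //; ring.
rewrite -[X in X + _]subr0; apply: cvgD; last first.
  by apply: cvgMl_tmp; exact: cvg_Rsum.
apply: cvgB; last exact: cvg_harmonic_tail_sum.
by apply: cvgM; [exact: cvg_zeta_conv | exact: cvg_ttilde].
Qed.

Lemma cvg_sum_antidiag n (f : nat -> nat -> nat -> R) (g : nat -> nat -> R) :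
  (forall i j, f N i j @[N --> \oo] --> g i j) ->
  sum_antidiag n (f N) @[N --> \oo] --> sum_antidiag n g.
Proof.
move=> fg; rewrite /sum_antidiag.
apply: (@cvg_bigsum R 'I_n.+1 _ (fun i N => f N i (n - i)%N)
  (fun i => g i (n - i)%N)) => i.
exact: fg.
Qed.

Lemma limit_identity m p q :
  sum_antidiag q.+1 (fun i j => 'C(m.+1 + i - 1, i)%:R * 'C(p.+1 + j - 1, j)%:R
      * (ttilde_conv R (m.+1 + i) * ttilde_conv R (p.+1 + j)))
  = 'C(m.+1 + p.+1 + q.+1 - 1, q.+1)%:R * ttilde R (m.+1 + p.+1 + q.+1)
  + sum_antidiag m (fun i j => (-1) ^+ i * 'C(p.+1 + i - 1, i)%:R
      * 'C(q.+2 + j - 1, j)%:R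
      * (zeta_conv R (p.+1 + i) * ttilde R (q.+2 + j)
         + (-1) ^+ (p.+1 + i) * Rsum R (p.+1 + i) (q.+2 + j)))
  + sum_antidiag p (fun i j => (-1) ^+ i * 'C(m.+1 + i - 1, i)%:R
      * 'C(q.+2 + j - 1, j)%:R
      * (zeta_conv R (m.+1 + i) * ttilde R (q.+2 + j)
         + (-1) ^+ (m.+1 + i) * Rsum R (m.+1 + i) (q.+2 + j))).
Proof.
pose f N i j : R := 'C(m.+1 + i - 1, i)%:R * 'C(p.+1 + j - 1, j)%:R
  * ((ttilde_upto N (m.+1 + i) - counterterm N (m.+1 + i))
     * (ttilde_upto N (p.+1 + j) - counterterm N (p.+1 + j))).
pose g a N i j : R := (-1) ^+ i * 'C(a.+1 + i - 1, i)%:R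
  * 'C(q.+2 + j - 1, j)%:R * weighted_harm (counterterm N) N (a.+1 + i) (q.+2 + j).
have cvg_f i j : f N i j @[N --> \oo] --> 'C(m.+1 + i - 1, i)%:R
    * 'C(p.+1 + j - 1, j)%:R
    * (ttilde_conv R (m.+1 + i) * ttilde_conv R (p.+1 + j)).
  by apply: cvgMl_tmp; apply: cvgM; exact: cvg_ttilde_conv.
have cvg_g a i j : g a N i j @[N --> \oo] --> (-1) ^+ i
    * 'C(a.+1 + i - 1, i)%:R * 'C(q.+2 + j - 1, j)%:R
    * (zeta_conv R (a.+1 + i) * ttilde R (q.+2 + j)
       + (-1) ^+ (a.+1 + i) * Rsum R (a.+1 + i) (q.+2 + j)).
  by apply: cvgMl_tmp; exact: cvg_weighted_harm.
apply: (cvg_unique _ (cvg_sum_antidiag q.+1 _ _ cvg_f)).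
  exact: norm_hausdorff.
rewrite /= (funext (fun N => finite_identity_regularized N m p q)).
apply: cvgD; last exact: (cvg_sum_antidiag p _ _ (cvg_g m)).
apply: cvgD; last exact: (cvg_sum_antidiag m _ _ (cvg_g p)).
by apply: cvgMl_tmp; apply: cvg_ttilde; rewrite !addSn addnS.
Qed.

End LimitIdentity.

(** * Membership in rational subalgebras *)

Section Membership.
Local Open Scope classical_set_scope.
Context {R : realType}.

Context {A : set R} (hA : is_Qsubalgebra A).

Lemma subalgebraM x y : A x -> A y -> A (x * y).
Proof. by case: hA => _ _ AM _; exact: AM. Qed.

Lemma subalgebraD x y : A x -> A y -> A (x + y).
Proof. by case: hA => _ AD _ _; exact: AD. Qed.

Lemma subalgebra_ratr a : A (ratr a).
Proof. by case: hA => A1 _ _ AZ; rewrite -[ratr a]mulr1; exact: AZ. Qed.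

Lemma subalgebra_nat n : A n%:R.
Proof. by rewrite -ratr_nat; exact: subalgebra_ratr. Qed.

Lemma subalgebraN x : A x -> A (- x).
Proof.
move=> Ax; rewrite -mulN1r; apply: subalgebraM => //.
by rewrite -(rmorphN1 (@ratr R)); exact: subalgebra_ratr.
Qed.

Lemma subalgebra_sign n : A ((-1) ^+ n).
Proof.
rewrite -signr_odd; case: odd; last exact: (subalgebra_nat 1).
by rewrite expr1; apply: subalgebraN; exact: (subalgebra_nat 1).
Qed.

Lemma subalgebra_sum_antidiag n (F : nat -> nat -> R) :
  (forall i j, A (F i j)) -> A (sum_antidiag n F).
Proof.
move=> AF; rewrite /sum_antidiag; elim/big_ind: _ => //.
- exact: (subalgebra_nat 0).
- exact: subalgebraD.
Qed.

Context (ln2_in : A (ln 2)).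
Context (zeta_in : forall k, (2 <= k)%N -> A (zeta R k)).

Lemma subalgebra_zeta_conv s : (0 < s)%N -> A (zeta_conv R s).
Proof.
move=> s0; rewrite /zeta_conv; case: eqP => [_|/eqP s1].
  by apply: subalgebraM => //; apply: subalgebraN; exact: subalgebra_nat.
by apply: zeta_in; rewrite ltn_neqAle eq_sym s1.
Qed.

Lemma subalgebra_ttilde_conv s : (0 < s)%N -> A (ttilde_conv R s).
Proof.
move=> s0; rewrite /ttilde_conv; case: eqP => [_|/eqP s1].
  exact: (subalgebra_nat 0).
have s2 : (2 <= s)%N by rewrite ltn_neqAle eq_sym s1.
rewrite ttildeE //; apply: subalgebraM; last exact: zeta_in.
apply: subalgebraD; first by rewrite -natrX; exact: subalgebra_nat.
by apply: subalgebraN; exact: (subalgebra_nat 1).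
Qed.

End Membership.

(** * The closed formula *)

(** Separates the zeta part from the [Rsum] part; the signs agree because
    (-1)^i * (-1)^(p+1+i) = (-1)^(p+1). *)
Lemma split_limit_sum (R : realType) (m p q : nat) :
  sum_antidiag m (fun i j => (-1) ^+ i * 'C(p.+1 + i - 1, i)%:R
      * 'C(q.+2 + j - 1, j)%:R
      * (zeta_conv R (p.+1 + i) * ttilde R (q.+2 + j)
         + (-1) ^+ (p.+1 + i) * Rsum R (p.+1 + i) (q.+2 + j)))
  = (-1) ^+ p.+1 * sum_antidiag m (fun i j =>
      'C(p.+1 + i - 1, i)%:R * 'C(q.+2 + j - 1, j)%:R * (-1) ^+ (p.+1 + i)
      * zeta_conv R (p.+1 + i) * ttilde_conv R (q.+2 + j))
  - (-1) ^+ p * sum_antidiag m (fun i j =>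
      'C(p.+1 + i - 1, i)%:R * 'C(q.+2 + j - 1, j)%:R
      * Rsum R (p.+1 + i) (q.+2 + j)).
Proof.
rewrite /sum_antidiag !mulr_sumr -sumrB; apply: eq_bigr => i _.
rewrite (_ : ttilde_conv R (q.+2 + _) = ttilde R (q.+2 + (m - i))) //.
rewrite [(-1) ^+ (p.+1 + i)]exprD exprS.
have hi := sqrr_sign R i; have hp := sqrr_sign R p.
set z := zeta_conv R _; set t := ttilde R _; set r := Rsum R _ _.
set b := 'C(_, i)%:R; set c := 'C(_, _)%:R.
move: z t r b c ((-1) ^+ i) ((-1) ^+ p) hi hp => z t r b c x y hi hp.
have -> : x * b * c * (z * t + -1 * y * x * r)
  = x * b * c * z * t - x ^+ 2 * (y * b * c * r) by ring.
have -> : -1 * y * (b * c * (-1 * y * x) * z * t)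
  = y ^+ 2 * (x * b * c * z * t) by ring.
by rewrite hi hp; ring.
Qed.

Theorem theorem4p1 (R : realType) (m p q : nat)
    (hm : (1 <= m)%N) (hp : (1 <= p)%N) (hq : (2 <= q)%N) :
  let lhs : R :=
    (-1) ^+ (m - 1)%N *
      sum_antidiag (p - 1) (fun i j : nat =>
        'C(m + i - 1, i)%:R * 'C(q + j - 1, j)%:R * Rsum R (m + i) (q + j))
    + (-1) ^+ (p - 1)%N *
      sum_antidiag (m - 1) (fun i j : nat =>
        'C(p + i - 1, i)%:R * 'C(q + j - 1, j)%:R * Rsum R (p + i) (q + j)) in
  Q_ln2_zeta lhs /\
  lhs =
    'C(m + p + q - 2, q - 1)%:R * ttilde_conv R (m + p + q - 1)
    + (-1) ^+ m *
      sum_antidiag (p - 1) (fun i j : nat =>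
        'C(m + i - 1, i)%:R * 'C(q + j - 1, j)%:R
        * (-1) ^+ (m + i)%N * zeta_conv R (m + i) * ttilde_conv R (q + j))
    + (-1) ^+ p *
      sum_antidiag (m - 1) (fun i j : nat =>
        'C(p + i - 1, i)%:R * 'C(q + j - 1, j)%:R
        * (-1) ^+ (p + i)%N * zeta_conv R (p + i) * ttilde_conv R (q + j))
    - sum_antidiag (q - 1) (fun i j : nat =>
        'C(m + i - 1, i)%:R * 'C(p + j - 1, j)%:R
        * ttilde_conv R (m + i) * ttilde_conv R (p + j)).
Proof.
move=> lhs; set rhs := (X in lhs = X).
suff eq_rhs : lhs = rhs.
  split=> //; rewrite eq_rhs /rhs.
  move=> A [hA gen_in].
  have ln2_in : A (ln 2) by apply: gen_in; left.
  have zeta_in k : (2 <= k)%N -> A (zeta R k).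
    by move=> k2; apply: gen_in; right; exists k.
  have ttilde_in := subalgebra_ttilde_conv hA zeta_in.
  have {}zeta_in := subalgebra_zeta_conv hA ln2_in zeta_in.
  have nat_in := subalgebra_nat hA; have sign_in := subalgebra_sign hA.
  have q0 : (0 < q)%N by apply: leq_trans hq.
  have term_in a b n : (0 < a)%N ->
    A ((-1) ^+ n * sum_antidiag (b - 1) (fun i j : nat =>
        'C(a + i - 1, i)%:R * 'C(q + j - 1, j)%:R
        * (-1) ^+ (a + i)%N * zeta_conv R (a + i) * ttilde_conv R (q + j))).
    move=> a0; apply: (subalgebraM hA) => //; apply: subalgebra_sum_antidiag => // i j.
    have := zeta_in (a + i)%N; have := ttilde_in (q + j)%N.
    rewrite !ltn_addr // => /(_ isT) t_in /(_ isT) z_in.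
    by do 4! [apply: (subalgebraM hA) => //].
  apply: (subalgebraD hA); last first.
    apply: subalgebraN => //; apply: subalgebra_sum_antidiag => // i j.
    have := ttilde_in (m + i)%N; have := ttilde_in (p + j)%N.
    rewrite !ltn_addr // => /(_ isT) tp_in /(_ isT) tm_in.
    by do 3! [apply: (subalgebraM hA) => //].
  apply: (subalgebraD hA); last exact: term_in.
  apply: (subalgebraD hA); last exact: term_in.
  by apply: (subalgebraM hA) => //; apply: ttilde_in; lia.
rewrite /lhs /rhs; clear lhs rhs.
case: m hm => // m _; case: p hp => // p _; case: q hq => // -[//|q] _.
rewrite !subn1 /=.
have sE : ttilde_conv R (m + p.+1 + q.+2) = ttilde R (m.+1 + p.+1 + q.+1).
  have -> : (m + p.+1 + q.+2 = (m + p + q).+3)%N by lia.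
  by have -> : (m.+1 + p.+1 + q.+1 = (m + p + q).+3)%N by lia.
have -> : (m.+1 + p.+1 + q.+2 - 2 = m.+1 + p.+1 + q.+1 - 1)%N by lia.
have -> : sum_antidiag q.+1 (fun i j => 'C(m.+1 + i - 1, i)%:R
    * 'C(p.+1 + j - 1, j)%:R * ttilde_conv R (m.+1 + i) * ttilde_conv R (p.+1 + j))
  = sum_antidiag q.+1 (fun i j => 'C(m.+1 + i - 1, i)%:R * 'C(p.+1 + j - 1, j)%:R
    * (ttilde_conv R (m.+1 + i) * ttilde_conv R (p.+1 + j))).
  by apply: eq_sum_antidiag => i j _; rewrite mulrA.
have regroup (T a b c d : R) :
  d + b = T + c + a - (T + (a - b) + (c - d)) by ring.
by rewrite sE limit_identity !split_limit_sum; exact: regroup.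
Qed.
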